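(* Let $\gamma,n$ be odd positive integers and $N$ a positive integer, and suppose $n$ starts an integral loop of length $N$ (for the map $C_\gamma$). Let $\rho$ and $\nu$ be the numbers of zeros and ones in a single period of the characteristic trajectory of $n$, and let $\mathcal{M}_n$ and $z_1,\ldots,z_\nu$ be the $\nu\times\nu$ matrix and the real numbers associated to $n$. Assume that $\nu$ is prime and that $z_1,\ldots,z_\nu$ are integers. Let $p$ be a prime factor of $2^\rho-3^\nu$, distinct from $\nu$, such that the residue class of $p$ modulo $\nu$ generates the whole multiplicative group $\mathbb{Z}_\nu^{*}$ of units modulo $\nu$. Then $p\nmid\det(\mathcal{M}_n)$ if and only if $p\nmid(z_1+\cdots+z_\nu)$ and $z_i\not\equiv z_j\pmod p$ for some $1\le i<j\le\nu$.
   Context: For an odd positive integer $\gamma$, $C_\gamma:\mathbb{Z}_{>0}\to\mathbb{Z}_{>0}$ is $C_\gamma(x)=3x+\gamma$ if $x$ is odd, $C_\gamma(x)=x/2$ if $x$ is even; $C_\gamma^k$ is the $k$-fold iterate ($C_\gamma^0=\mathrm{id}$). $n$ starts an integral loop of length $N$ if $N$ is the least positive integer with $C_\gamma^N(n)=n$. $\chi_\gamma^i(n)\in\{0,1\}$ is the parity of $C_\gamma^i(n)$ ($1$ if odd, $0$ if even); the characteristic trajectory is $B=(\chi_\gamma^i(n))_{i\ge0}$, and a single period consists of the indices $0\le i\le N-1$. For $n$ odd, let $0=i_0<i_1<\cdots<i_{\nu-1}\le N-1$ be the indices in $[0,N-1]$ with $\chi_\gamma^{i_j}(n)=1$. For $1\le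 j\le\nu-1$, $m_j$ is the number of zeros of $B$ strictly between positions $i_{j-1}$ and $i_j$, and $m_\nu$ is the number of zeros at positions after $i_{\nu-1}$ and at most $N-1$. Let $|j|_\nu\in\{0,\ldots,\nu-1\}$ be $j$ modulo $\nu$ and $e_{j,k}$ the $\nu\times\nu$ matrix units. Define $\mathcal{D}_n=\sum_{j=1}^\nu 2^{m_j}e_{j,|j|_\nu+1}$ and $\mathcal{M}_n=\sum_{k=1}^{\nu}\mathcal{D}_n^{k-1}\sum_{j=1}^\nu e_{j,k}$ (with $\mathcal{D}_n^0$ the identity), an integer matrix. For $1\le i\le\nu$ let $z_i=2^{\frac1\nu\sum_{k=1}^{\nu-1}k\,m_{|i+k-2|_\nu+1}}$. *)

(* Defs.v *)
From HB Require Import structures.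
From mathcomp Require Import all_boot all_order all_algebra all_fingroup all_solvable.
From mathcomp Require Import reals exp.

Set Implicit Arguments.
Unset Strict Implicit.
Unset Printing Implicit Defensive.

Import Order.TTheory GRing.Theory Num.Theory.

(* The positive integers are invariant under this map when gamma is positive,
   so its value at 0 plays no role in the orbit of a positive integer. *)
Definition collatz (gamma x : nat) : nat :=
  if odd x then 3 * x + gamma else x./2.

Definition starts_loop (gamma n N : nat) : Prop :=
  [/\ 0 < N,
      iter N (collatz gamma) n = n
    & forall k, 0 < k < N -> iter k (collatz gamma) n <> n].

Definition chi (gamma n i : nat) : bool := odd (iter i (collatz gamma) n).

Definition num_ones (gamma n N : nat) : nat :=
  count (fun i => chi gamma n i) (iota 0 N).

Definition num_zeros (gamma n N : nat) : nat :=
  count (fun i => ~~ chi gamma n i) (iota 0 N).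

(* The increasing sequence i_0 < i_1 < ... < i_{nu-1}. *)
Definition ones (gamma n N : nat) : seq nat :=
  [seq i <- iota 0 N | chi gamma n i].

(* Indices are shifted to start at 0: gap gamma n N j is m_{j+1}, for j < nu.
   The default value N of nth makes j = nu - 1 count the zeros at the positions
   after i_{nu-1} and at most N - 1. *)
Definition gap (gamma n N j : nat) : nat :=
  let s := ones gamma n N in
  count (fun t => ~~ chi gamma n t) (index_iota (nth N s j).+1 (nth N s j.+1)).

Local Open Scope ring_scope.

(* With 0-based rows and columns, |j|_nu + 1 becomes the cyclic successor ordS. *)
Definition mxD (nu : nat) (m : nat -> nat) : 'M[int]_nu :=
  \sum_(j < nu) 2 ^+ m j *: delta_mx j (ordS j).

Definition mxM (nu : nat) (m : nat -> nat) : 'M[int]_nu :=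
  \sum_(k < nu) mxD nu m ^+ k *m \sum_(j < nu) delta_mx j k.

(* zval R nu m i is z_{i+1}, so the index |(i+1)+k-2|_nu + 1 of m becomes
   (i + k - 1) mod nu; the predecessor is exact since k >= 1. *)
Definition zval (R : realType) (nu : nat) (m : nat -> nat) (i : nat) : R :=
  2 `^ (nu%:R^-1 * \sum_(1 <= k < nu) k%:R * (m ((i + k).-1 %% nu)%N)%:R).

(* For nu = 1 the ring 'Z_nu is not the ring of integers modulo nu; the predicate
   is meant for nu > 1. *)
Definition generates_units_mod (nu p : nat) : Prop :=
  exists2 u : {unit 'Z_nu}, val u = p%:R & generator (units_Zp nu) u.

(* Main.v *)
Require Import Defs.
From HB Require Import structures.
From mathcomp Require Import all_boot all_order all_algebra all_fingroup all_solvable.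
From mathcomp Require Import separable closed_field cyclotomic.
From mathcomp Require Import reals exp.
From mathcomp Require Import ring zify.

Set Implicit Arguments.
Unset Strict Implicit.
Unset Printing Implicit Defensive.

Import Order.TTheory GRing.Theory Num.Theory.
Local Open Scope ring_scope.

(** The number z_i satisfies z_(i+1) * 2^(rho/nu) = z_i * 2^(m_(i-1)), indices
    being cyclic and, as for matrices, counted from 0.  When all the z_i are
    integers they are powers of 2, and comparing exponents shows that nu divides
    the sum of the gaps; so q = 2^(rho/nu) is an integer too.  With
    y_j = z_(j+1) this reads y_j * 2^(m_j) = q * y_(j+1), and induction on k
    turns it into
    y_j * M_(j,k) = q^k * y_(j+k)  ([mxD_pow_row_sum]).
    Up to diagonal factors that are powers of 2, the matrix M is thus the cyclic
    Hankel matrix (y_(j+k)), and p is odd, so p divides det M if and only if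
    it divides the Hankel determinant ([det_mxM_hankel]).

    Let L be a field of characteristic p with a primitive nu-th root of unity w.
    Multiplying the Hankel matrix of y by the Vandermonde matrix of the powers
    of w gives the diagonal matrix of the values
    Y(w^i) = sum_k y_k w^(i k), times the Vandermonde matrix of the powers of
    w^-1 ([dft_mx_hankel]).  So the determinant vanishes in L exactly when some
    Y(w^i) does.  Since the y_k lie in the prime field, Y(x^p) = Y(x)^p; and
    since p generates the units modulo nu, the nontrivial nu-th roots of unity
    form a single Frobenius orbit: either Y vanishes at all of them or at none.
    If Y vanishes at all of them, then y is constant modulo p
    ([dft_eq0_const]); conversely a constant sequence has Y(w) = 0.  The
    remaining value Y(1) is the sum of the z_i.  This is the claim
    ([dvdz_det_hankel]).

    The prime p is odd because an odd number of the loop is followed by an even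
    one: hence rho > 0, and 2^rho - 3^nu is odd. *)

(** * Periodic sequences *)

Definition periodic (T : Type) (n : nat) (f : nat -> T) : Prop :=
  forall k, f (k + n)%N = f k.

Lemma sum_periodic (V : nmodType) (n : nat) (f : nat -> V) (l : nat) :
  periodic n f -> \sum_(k < n) f (k + l)%N = \sum_(k < n) f k.
Proof.
move=> fper; elim: l => [|l IHl]; first by under eq_bigr do rewrite addn0.
rewrite -[RHS]IHl; case: n fper {IHl} => [|n] fper; first by rewrite !big_ord0.
rewrite big_ord_recr big_ord_recl /= addnS -addSn addnC fper addrC.
by congr (_ + _); apply: eq_bigr => k _; rewrite addnS.
Qed.

Lemma periodic_modn (T : Type) (n : nat) (f : nat -> T) (k : nat) :
  periodic n f -> f (k %% n)%N = f k.
Proof.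
move=> fper; rewrite [in RHS](divn_eq k n) addnC.
by elim: (k %/ n)%N => [|d IHd]; rewrite ?addn0 // mulSn addnCA addnC fper.
Qed.

(** * Determinants of cyclic Hankel matrices *)

Definition hankel (T : Type) (n : nat) (c : nat -> T) : 'M[T]_n :=
  \matrix_(i, j) c (i + j)%N.

(** The discrete Fourier transform of c: the value at w^i of the polynomial
    with coefficients c. *)
Definition dft (L : fieldType) (n : nat) (w : L) (c : nat -> L) (i : nat) : L :=
  \sum_(k < n) c k * w ^+ (i * k).

Definition dft_mx (L : fieldType) (n : nat) (w : L) : 'M[L]_n :=
  Vandermonde n (\row_j w ^+ j).

Lemma det_dft_mx_neq0 (L : fieldType) (n : nat) (w : L) :
  n.-primitive_root w -> \det (dft_mx n w) != 0.
Proof.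
move=> wP; rewrite det_Vandermonde.
apply/prodf_neq0 => i _; apply/prodf_neq0 => j lt_ij.
rewrite !mxE subr_eq0 (eq_prim_root_expr wP) !modn_small ?ltn_ord //.
by rewrite gtn_eqF.
Qed.

(** Entry (i, j) of the product is sum_k w^(i k) c_(k+j).  Multiplied by w^(i j)
    it is a sum of the periodic function k |-> c_k w^(i k) over a full period,
    shifted by j, and so equals the transform of c at i. *)
Lemma dft_mx_hankel (L : fieldType) (n : nat) (w : L) (c : nat -> L) :
    n.-primitive_root w -> periodic n c ->
  dft_mx n w *m hankel n c = diag_mx (\row_i dft n w c i) *m dft_mx n w^-1.
Proof.
move=> wP cper.
have w_neq0 : w != 0 by rewrite (prim_root_eq0 wP) -lt0n (prim_order_gt0 wP).
apply/matrixP=> i j; rewrite mul_diag_mx !mxE.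
under eq_bigr do rewrite !mxE.
rewrite -exprM exprVn mulnC -[LHS](mulfK (expf_neq0 (i * j) w_neq0)).
congr (_ * _); rewrite mulr_suml /dft.
rewrite -(sum_periodic (f := fun k => c k * w ^+ (i * k)) j); last first.
  move=> k; rewrite cper mulnDr exprD [w ^+ (i * n)]exprM exprAC.
  by rewrite (prim_expr_order wP) expr1n mulr1.
by apply: eq_bigr => k _; rewrite mulnDr exprD -exprM [(k * i)%N]mulnC; ring.
Qed.

Lemma inv_prim_root (L : fieldType) (n : nat) (w : L) :
  n.-primitive_root w -> n.-primitive_root w^-1.
Proof.
case/andP=> n_gt0 /forallP ordw; rewrite /primitive_root_of_unity n_gt0.
by apply/forallP=> i; rewrite unity_rootE exprVn invr_eq1 -unity_rootE ordw.
Qed.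

Lemma det_hankel_eq0 (L : fieldType) (n : nat) (w : L) (c : nat -> L) :
    n.-primitive_root w -> periodic n c ->
  (\det (hankel n c) == 0) = [exists i : 'I_n, dft n w c i == 0].
Proof.
move=> wP cper; have /(congr1 determinant) := dft_mx_hankel wP cper.
rewrite !det_mulmx det_diag => eq_det.
have F0 := det_dft_mx_neq0 wP; have F'0 := det_dft_mx_neq0 (inv_prim_root wP).
transitivity (\prod_(i < n) (\row_i dft n w c i) 0 i == 0).
  move/(congr1 (fun x => x == 0)): eq_det; rewrite !mulf_eq0.
  by rewrite (negPf F0) (negPf F'0) orbF.
apply/prodf_eq0/existsP => [[i _]|[i ci0]]; first by rewrite mxE; exists i.
by exists i; rewrite ?mxE.
Qed.

(** Multiply the Hankel matrix of c by the invertible Fourier matrix: only row 0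
    of the product is nonzero, and it is constant, so all columns of the product
    agree.  Hence all columns of the Hankel matrix agree. *)
Lemma dft_eq0_const (L : fieldType) (n : nat) (w : L) (c : nat -> L) :
    n.-primitive_root w -> periodic n c ->
    (forall i : nat, (0 < i < n)%N -> dft n w c i = 0) ->
  forall j k : nat, c j = c k.
Proof.
move=> wP cper c0.
have n_gt0 := prim_order_gt0 wP.
suffices c_const (j : 'I_n) : c j = c 0%N.
  move=> j k; rewrite -(periodic_modn j cper) -(periodic_modn k cper).
  by rewrite (c_const (Ordinal (ltn_pmod j n_gt0)))
             (c_const (Ordinal (ltn_pmod k n_gt0))).
pose H := hankel n c; pose o := Ordinal n_gt0.
suffices: col j H = col o H.
  by move/colP/(_ o); rewrite !mxE addn0 add0n.
have F_unit : dft_mx n w \in unitmx by rewrite unitmxE unitfE det_dft_mx_neq0.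
apply: (can_inj (mulKmx F_unit)); rewrite !colE !mulmxA dft_mx_hankel // -!colE.
rewrite mul_diag_mx; apply/colP=> i; rewrite !mxE.
have [i0|i_gt0] := posnP i; first by rewrite i0 !expr0.
by rewrite c0 ?i_gt0 ?ltn_ord // !mul0r.
Qed.

(** * Divisibility of cyclic Hankel determinants *)

(** Frobenius fixes the coefficients c_k, so it sends the value at x of the
    polynomial with these coefficients to the value at x^p. *)
Lemma dft_Frobenius (L : fieldType) (p n : nat) (w : L) (c : nat -> L)
    (t : nat) :
    p \in [pchar L] -> (forall k, c k ^+ p = c k) ->
  forall i, dft n w c (i * p ^ t) = dft n w c i ^+ (p ^ t).
Proof.
move=> Lp cp i; elim: t => [|t IHt]; first by rewrite muln1 expr1.
rewrite expnSr exprM -IHt -(pFrobenius_autE Lp) rmorph_sum /=.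
apply: eq_bigr => k _; rewrite pFrobenius_autE exprMn cp -exprM.
by congr (_ * _ ^+ _); rewrite mulnA mulnAC.
Qed.

(** The powers of a generator act transitively by multiplication on the nonzero
    residues modulo the prime nu; this makes the nontrivial nu-th roots of unity
    a single Frobenius orbit. *)
Lemma generates_units_mod_pow (nu p i j : nat) :
    prime nu -> generates_units_mod nu p ->
    (0 < i < nu)%N -> (0 < j < nu)%N ->
  exists t, (i * p ^ t = j %[mod nu])%N.
Proof.
move=> nu_prime [u up /eqP u_gen] i_nu j_nu.
have nu_gt1 := prime_gt1 nu_prime.
have unitP k : (0 < k < nu)%N -> (k%:R : 'Z_nu) \is a GRing.unit.
  case/andP=> k_gt0 k_nu; rewrite unitZpE // prime_coprime //.
  by rewrite gtnNdvd.
pose ui : {unit 'Z_nu} := @FinRing.Unit _ i%:R (unitP i i_nu).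
pose uj : {unit 'Z_nu} := @FinRing.Unit _ j%:R (unitP j j_nu).
have /cycleP[t ut] : (ui^-1 * uj)%g \in <[u]>%g by rewrite -u_gen inE.
exists t; rewrite -!(val_Zp_nat nu_gt1); congr nat_of_ord.
rewrite natrM natrX -up -FinRing.val_unitX -ut FinRing.val_unitM.
by rewrite FinRing.val_unitV /= mulVKr ?unitP.
Qed.

(** Since p does not divide n, X^n - 1 is separable in characteristic p, so it
    has n distinct roots in an algebraic closure of the prime field. *)
Lemma prim_root_pchar_exists (p n : nat) :
    prime p -> coprime p n -> (0 < n)%N ->
  exists (L : closedFieldType) (w : L),
    p \in [pchar L] /\ n.-primitive_root w.
Proof.
move=> p_prime pn n_gt0.
have [L [f _]] := countable_algebraic_closure 'F_p.
have Lp : p \in [pchar L] by rewrite (fmorph_pchar f) pchar_Fp.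
exists L.
pose q : {poly L} := 'X^n - 1; have [r Dq] := closed_field_poly_normal q.
rewrite (monicP _) ?monicXnsubC // scale1r in Dq.
have rn1: all n.-unity_root r by apply/allP=> z; rewrite -root_prod_XsubC -Dq.
have sz_r: (n < (size r).+1)%N.
  by rewrite -(size_prod_XsubC r id) -Dq size_XnsubC.
have [|w _ wP] := hasP (has_prim_root n_gt0 rn1 _ sz_r); last by exists w.
rewrite -separable_prod_XsubC -Dq separable_Xn_sub_1 //.
by rewrite -(dvdn_pcharf Lp) -prime_coprime.
Qed.

(** If the transform of y vanishes at some i > 0, Frobenius carries this zero to
    every nonzero index, and then y is constant modulo p. *)
Lemma dvdz_det_hankel (nu p : nat) (y : nat -> int) :
    prime nu -> prime p -> p <> nu -> generates_units_mod nu p ->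
    periodic nu y ->
  (p%:Z %| \det (hankel nu y))%Z <->
  (p%:Z %| \sum_(i < nu) y i)%Z \/ (forall i j, (y i = y j %[mod p%:Z])%Z).
Proof.
move=> nu_prime p_prime /eqP p_nu p_gen yper.
have nu_gt1 := prime_gt1 nu_prime; have nu_gt0 := prime_gt0 nu_prime.
have [||//|L [w [Lp wP]]] := @prim_root_pchar_exists p nu; first by [].
  by rewrite prime_coprime // dvdn_prime2.
pose c k : L := (y k)%:~R.
have cper : periodic nu c by move=> k; rewrite /c yper.
have c_mod i j : c i = c j <-> (y i = y j %[mod p%:Z])%Z.
  rewrite (rwP eqP) (rwP (eqP : reflect (y i %% p = y j %% p)%Z _)).
  by rewrite eqz_mod_dvd (dvdz_pcharf Lp) rmorphB subr_eq0.
have dft0 : dft nu w c 0 = (\sum_(i < nu) y i)%:~R.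
  by rewrite rmorph_sum /=; apply: eq_bigr => k _; rewrite mul0n mulr1.
rewrite !(dvdz_pcharf Lp) -dft0.
have -> : (\det (hankel nu y))%:~R = \det (hankel nu c).
  by rewrite -det_map_mx; congr (\det _); apply/matrixP=> i j; rewrite !mxE.
rewrite (det_hankel_eq0 wP cper); split=> [/existsP[i ci0]|].
  have [i0|i_gt0] := posnP i; first by left; rewrite -i0.
  right=> j k; apply/c_mod/(dft_eq0_const wP cper) => l l_nu.
  have i_nu : (0 < i < nu)%N by rewrite i_gt0 ltn_ord.
  have [t it_l] := generates_units_mod_pow nu_prime p_gen i_nu l_nu.
  have <- : dft nu w c (i * p ^ t) = dft nu w c l.
    apply: eq_bigr => m _; congr (_ * _); apply/eqP.
    by rewrite (eq_prim_root_expr wP) -modnMml it_l modnMml.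
  rewrite (dft_Frobenius _ _ _ Lp) => [|m]; last first.
    by rewrite -(pFrobenius_autE Lp) pFrobenius_aut_int.
  by rewrite (eqP ci0) expr0n expn_eq0 -leqn0 leqNgt prime_gt0.
case=> [c0|yconst]; apply/existsP; first by exists (Ordinal nu_gt0).
(* The transform of a constant vanishes at 1, as w is a nontrivial root of
   unity. *)
exists (Ordinal nu_gt1); rewrite /dft /=.
under eq_bigr do rewrite mul1n (proj2 (c_mod _ 0%N) (yconst _ 0%N)).
rewrite -mulr_sumr mulf_eq0; apply/orP; right.
have w1 : w - 1 != 0.
  by rewrite subr_eq0 -(expr1 w) -(prim_order_dvd wP) gtnNdvd.
by rewrite -(mulrI_eq0 _ (mulfI w1)) -subrX1 (prim_expr_order wP) subrr.
Qed.

(** * Reduction of the loop matrix to a Hankel matrix *)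

(** Column k of the loop matrix is the k-th power of the weighted cyclic shift
    applied to the all-ones vector. *)
Lemma mxM_row_sum (nu : nat) (m : nat -> nat) (i k : 'I_nu) :
  mxM nu m i k = \sum_l (mxD nu m ^+ k) i l.
Proof.
have col1 (h l : 'I_nu) :
  (\sum_(j < nu) delta_mx j h : 'M[int]_nu) l k = (k == h)%:R.
  rewrite summxE (bigD1 l) //= mxE eqxx big1 ?addr0 // => j /negPf jl.
  by rewrite mxE eq_sym jl.
rewrite /mxM summxE (bigD1 k) //= [X in _ + X]big1 ?addr0 => [|h /negPf h_k].
  by rewrite mxE; apply: eq_bigr => l _; rewrite col1 eqxx mulr1.
by rewrite mxE big1 // => l _; rewrite col1 eq_sym h_k mulr0.
Qed.

(** Conjugating by the diagonal matrix of the y_i turns the weighted shift into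
    q times the plain cyclic shift, whose k-th power moves y_i to y_(i+k). *)
Lemma mxD_pow_row_sum (nu : nat) (m : nat -> nat) (y : nat -> int) (q : int) :
    periodic nu y ->
    (forall i : 'I_nu, y i * 2 ^+ m i = q * y i.+1) ->
  forall (k : nat) (i : 'I_nu),
    y i * \sum_l (mxD nu m ^+ k) i l = q ^+ k * y (i + k)%N.
Proof.
move=> yper yq; elim=> [|k IHk] i.
  rewrite expr0 (bigD1 i) //= big1 => [|l /negPf li]; last first.
    by rewrite mxE eq_sym li.
  by rewrite mxE eqxx addn0 addr0 mulr1 mul1r.
have -> : \sum_l (mxD nu m ^+ k.+1) i l
          = 2 ^+ m i * \sum_l (mxD nu m ^+ k) (ordS i) l.
  rewrite mulr_sumr; apply: eq_bigr => l _.
  rewrite exprS -mulmxE mxE (bigD1 (ordS i)) //= big1 ?addr0 => [|h h_i].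
    rewrite /mxD summxE (bigD1 i) //= !mxE !eqxx big1 ?addr0 ?mulr1 // => j ji.
    by rewrite !mxE eq_sym (negPf ji) mulr0.
  rewrite /mxD summxE big1 ?mul0r // => j _; rewrite !mxE.
  by case: eqP => [<-|_]; rewrite ?(negPf h_i) ?andbF mulr0.
have ySi : y (ordS i) = y i.+1 by rewrite /= periodic_modn.
have ySik : y (ordS i + k)%N = y (i + k.+1)%N.
  by rewrite -(periodic_modn _ yper) /= modnDml periodic_modn // addSnnS.
by rewrite mulrA yq -ySi -mulrA IHk ySik exprS mulrA.
Qed.

Lemma det_mxM_hankel (nu : nat) (m : nat -> nat) (y : nat -> int) (q : int) :
    periodic nu y ->
    (forall i : 'I_nu, y i * 2 ^+ m i = q * y i.+1) ->
  (\prod_(i < nu) y i) * \det (mxM nu m)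
    = \det (hankel nu y) * \prod_(k < nu) q ^+ k.
Proof.
move=> yper yq.
have : diag_mx (\row_i y i) *m mxM nu m
         = hankel nu y *m diag_mx (\row_(k < nu) q ^+ k).
  apply/matrixP=> i k; rewrite mul_diag_mx mul_mx_diag !mxE mxM_row_sum.
  by rewrite (mxD_pow_row_sum yper yq) mulrC.
move/(congr1 determinant); rewrite !det_mulmx !det_diag.
by under eq_bigr do rewrite mxE; under [X in _ = _ * X]eq_bigr do rewrite mxE.
Qed.

(** * Integrality of the z_i *)

(** The exponent of 2 in the nu-th power of [zval] at index i + 1; moving the
    index by one absorbs the predecessor that occurs in [zval]. *)
Definition zexp (nu : nat) (m : nat -> nat) (i : nat) : nat :=
  (\sum_(k < nu) k * m ((i + k) %% nu))%N.

(** Adding the sum of all gaps raises each weight k of the shifted sum to k + 1,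
    which is the unshifted sum with an extra term of weight nu. *)
Lemma zexpS (nu : nat) (m : nat -> nat) (i : nat) :
  (zexp nu m i.+1 + \sum_(k < nu) m k = zexp nu m i + nu * m (i %% nu))%N.
Proof.
pose g k := m (k %% nu)%N.
have gper : periodic nu g by move=> k; rewrite /g modnDr.
have -> : (\sum_(k < nu) m k = \sum_(k < nu) g (k + i.+1))%N.
  by rewrite (sum_periodic (V := nat) _ gper);
    apply: eq_bigr => k _; rewrite /g modn_small.
rewrite /zexp -big_split /=.
transitivity (\sum_(k < nu) k.+1 * g (i + k.+1))%N.
  by apply: eq_bigr => k _; rewrite mulSn addnC addSnnS [(k + _)%N]addnC addnS.
rewrite -[LHS]add0n -(mul0n (g (i + 0))%N).
rewrite -(big_ord_recl nu (fun k => k * g (i + k))%N) big_ord_recr /=.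
by rewrite gper.
Qed.

Lemma zval_expn (R : realType) (nu : nat) (m : nat -> nat) (i : nat) :
  (0 < nu)%N -> zval R nu m (i.+1 %% nu) ^+ nu = 2 ^+ zexp nu m i.
Proof.
move=> nu_gt0; rewrite -powR_mulrn ?powR_ge0 // /zval -powRrM.
rewrite mulrAC mulVf ?pnatr_eq0 -?lt0n // mul1r -powR_mulrn //; congr (_ `^ _).
rewrite /zexp -(big_mkord xpredT (fun k => k * m ((i + k) %% nu))%N).
rewrite big_ltn // mul0n add0n natr_sum; apply: eq_big_nat => -[//|k] _.
by rewrite natrM addnS /= modnDml addSnnS.
Qed.

Lemma root_pow2 (x : int) (n e : nat) : (0 < n)%N -> 0 <= x ->
  x ^+ n = 2 ^+ e -> exists2 a, x = 2 ^+ a & (a * n = e)%N.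
Proof.
move=> n_gt0; case: x => // x _ /(congr1 absz); rewrite !abszX /= => xe.
have /(dvdn_pfactor _ _ (isT : prime 2))[a _ xa] : (x %| 2 ^ e)%N.
  by rewrite -xe dvdn_exp.
exists a; first by rewrite xa -natz natrX.
by apply/eqP; rewrite -(eqn_exp2l _ _ (isT : (1 < 2)%N)) -xe xa expnM.
Qed.

(** Integers whose nu-th powers are powers of 2 are powers of 2 themselves, so
    nu divides every [zexp]; by [zexpS] it then divides the sum of the gaps, and
    r is the quotient. *)
Lemma zval_int_succ (R : realType) (nu : nat) (m : nat -> nat)
    (y : nat -> int) :
    (0 < nu)%N ->
    (forall i, zval R nu m (i.+1 %% nu) = (y i)%:~R) ->
    (forall i, exists a, y i = 2 ^+ a) /\
  exists r, forall i, y i * 2 ^+ m (i %% nu)%N = 2 ^+ r * y i.+1.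
Proof.
move=> nu_gt0 hy.
have y_pow i : exists2 a, y i = 2 ^+ a & (a * nu = zexp nu m i)%N.
  apply: root_pow2 => //; first by rewrite -(ler0z R) -hy powR_ge0.
  by apply: (@intr_inj R); rewrite !rmorphXn /= -hy zval_expn.
split=> [i|]; first by have [a ya _] := y_pow i; exists a.
have nu_dvd : (nu %| \sum_(k < nu) m k)%N.
  have [[a0 _ a0e] [a1 _ a1e]] := (y_pow 0, y_pow 1)%N.
  have := zexpS nu m 0; rewrite -a0e -a1e => e.
  have : (nu %| a1 * nu + \sum_(k < nu) m k)%N.
    by rewrite e; apply: dvdn_add; [exact: dvdn_mull | exact: dvdn_mulr].
  by rewrite dvdn_addr // dvdn_mull.
have /dvdnP[r Sr] := nu_dvd; exists r => i.
have [[a -> ae] [b -> be]] := (y_pow i, y_pow i.+1).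
rewrite -!exprD; congr (_ ^+ _); apply/eqP; rewrite -(eqn_pmul2r nu_gt0).
by have := zexpS nu m i; rewrite Sr -ae -be; lia.
Qed.

(** * Oddness of the prime, and the theorem *)

(** An odd number is followed by an even one, and a loop of length 1 at an odd
    number is impossible because the map increases it. *)
Lemma num_zeros_gt0 (gamma n N : nat) :
  odd gamma -> odd n -> starts_loop gamma n N -> (0 < num_zeros gamma n N)%N.
Proof.
move=> g_odd n_odd [N_gt0 loopN _].
have step : collatz gamma n = (3 * n + gamma)%N by rewrite /collatz n_odd.
have N_gt1 : (1 < N)%N.
  case: N => [|[|N]] // in N_gt0 loopN *; move: loopN; rewrite /= step.
  by lia.
rewrite -has_count; apply/hasP; exists 1%N; first by rewrite mem_iota.
by rewrite /chi /= step oddD oddM n_odd g_odd.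
Qed.

Lemma dvdz_pow2_pow3_neq2 (p r s : nat) :
  (0 < r)%N -> (p%:Z %| 2 ^+ r - 3 ^+ s)%Z -> p != 2%N.
Proof.
move=> r_gt0; apply: contraTneq => ->.
rewrite (dvdz_pcharf (pchar_Fp (isT : prime 2))) rmorphB !rmorphXn /=.
have -> : 2%:~R = 0 :> 'F_2 by apply: val_inj.
have -> : 3%:~R = 1 :> 'F_2 by apply: val_inj.
by rewrite expr0n gtn_eqF // expr1n sub0r oppr_eq0 oner_eq0.
Qed.

Theorem theorem1p5p6 (R : realType) (gamma n N rho nu p : nat)
    (hgamma : odd gamma) (hn : odd n)
    (hloop : starts_loop gamma n N)
    (hrho : rho = num_zeros gamma n N)
    (hnu : nu = num_ones gamma n N)
    (nu_prime : prime nu)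
    (z : 'I_nu -> int)
    (hz : forall i : 'I_nu, zval R nu (gap gamma n N) i = (z i)%:~R)
    (p_prime : prime p)
    (p_dvd : (p%:Z %| 2 ^+ rho - 3 ^+ nu)%Z)
    (p_neq_nu : p <> nu)
    (p_gen : generates_units_mod nu p) :
  ~~ (p%:Z %| \det (mxM nu (gap gamma n N)))%Z <->
  ~~ (p%:Z %| \sum_(i < nu) z i)%Z /\
  (exists i j : 'I_nu, (i < j)%N /\ (z i != z j %[mod p%:Z])%Z).
Proof.
have nu_gt0 := prime_gt0 nu_prime; set m := gap gamma n N.
have p_neq2 : p != 2%N.
  by apply: dvdz_pow2_pow3_neq2 p_dvd; rewrite hrho (num_zeros_gt0 hgamma hn hloop).
pose zz k := z (Ordinal (ltn_pmod k nu_gt0)); pose y k := zz k.+1.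
have zzper : periodic nu zz.
  by move=> k; congr z; apply: val_inj; rewrite /= modnDr.
have zzE (i : 'I_nu) : zz i = z i.
  by congr z; apply: val_inj; rewrite /= modn_small.
have yper : periodic nu y by move=> k; rewrite /y -addSn zzper.
have sum_y : \sum_(i < nu) y i = \sum_(i < nu) z i.
  rewrite -(eq_bigr _ (fun i _ => zzE i)) -(sum_periodic 1 zzper).
  by apply: eq_bigr => i _; rewrite addn1.
(* y_i has index i + 1 in z, so that the gap linking y_i to y_(i+1) is m_i. *)
have [y_pow [r yq]] : (forall i, exists a, y i = 2 ^+ a) /\
    exists r, forall i, y i * 2 ^+ m (i %% nu)%N = 2 ^+ r * y i.+1.
  by apply: (@zval_int_succ R) => // i; rewrite -hz.
have det_eq : (\prod_(i < nu) y i) * \det (mxM nu m)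
               = \det (hankel nu y) * \prod_(k < nu) (2 ^+ r) ^+ k.
  by apply: det_mxM_hankel => // i; rewrite -yq modn_small.
have pow2_neq0 a : (2 ^+ a)%:~R != 0 :> 'F_p.
  rewrite -(dvdz_pcharf (pchar_Fp p_prime)) dvdzE abszX Euclid_dvdX //.
  by rewrite dvdn_prime2 // (negPf p_neq2).
have -> : (p%:Z %| \det (mxM nu m))%Z = (p%:Z %| \det (hankel nu y))%Z.
  rewrite !(dvdz_pcharf (pchar_Fp p_prime)).
  move/(congr1 (fun x : int => x%:~R == 0 :> 'F_p)): det_eq.
  rewrite !rmorphM !rmorph_prod /= !mulf_eq0.
  suff [/negPf-> /negPf->] :
    \prod_(i < nu) (y i)%:~R != 0 :> 'F_p /\
    \prod_(k < nu) ((2 ^+ r) ^+ k)%:~R != 0 :> 'F_p by rewrite orbF.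
  split; apply/prodf_neq0 => i _; last by rewrite -exprM.
  by have [a ->] := y_pow i.
have [det_dvd dvd_det] := dvdz_det_hankel nu_prime p_prime p_neq_nu p_gen yper.
rewrite sum_y in det_dvd dvd_det.
split=> [det_ndvd|[sum_ndvd [i [j [_ z_ij]]]]].
  split; first by apply: contra det_ndvd => ?; apply: dvd_det; left.
  have [/existsP[i /existsP[j /andP[ij z_ij]]]|all_eq] := boolP
    [exists i : 'I_nu, exists j : 'I_nu,
       (i < j)%N && (z i != z j %[mod p%:Z])%Z]; first by exists i, j.
  have z_eq (i j : 'I_nu) : (z i = z j %[mod p%:Z])%Z.
    wlog ij : i j / (i <= j)%N => [H|].
      by case: (leqP i j) => [|/ltnW] /H.
    have [/ord_inj-> //|ne_ij] := eqVneq (i : nat) j.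
    apply/eqP; apply: contraR all_eq => z_ij.
    by apply/existsP; exists i; apply/existsP; exists j;
      rewrite ltn_neqAle ne_ij ij.
  by case/negP: det_ndvd; apply: dvd_det; right=> i j; apply: z_eq.
apply/negP=> /det_dvd[|y_eq]; first exact/negP.
case/eqP: z_ij.
(* Index k of z is index k - 1 of y; adding nu keeps it nonnegative. *)
have shift (k : 'I_nu) : z k = y (k + nu.-1)%N.
  by rewrite /y -addnS prednK // zzper zzE.
by rewrite !shift; apply: y_eq.
Qed.
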